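(* Let $0<p\le 1$ (possibly depending on $n$). Then, with high probability as $n\to\infty$, \[D\big(G(n,p), C^\circlearrowright_{3}\big) \le \exp\bigg(\frac{6n(\log n)^2}{p}\bigg).\]
   Context: $G(n,p)$ is the Erdős–Rényi random graph on $n$ vertices with edge probability $p$. For a graph $G$ and an oriented graph $\vec H$, $D(G,\vec H)$ is the number of orientations of $G$ containing no copy of $\vec H$; $C^\circlearrowright_3$ is the directed triangle. *)

(* Defs.v *)
From HB Require Import structures.
From mathcomp Require Import all_boot all_order all_algebra.

Set Implicit Arguments.
Unset Strict Implicit.
Unset Printing Implicit Defensive.

Import Order.TTheory GRing.Theory Num.Theory.

Definition pairs (T : finType) : {set {set T}} := [set e : {set T} | #|e| == 2].

Record sgraph (T : finType) := SGraph {
  edges : {set {set T}};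
  edges_pairs : edges \subset pairs T }.

HB.instance Definition _ (T : finType) := [isSub for @edges T].
HB.instance Definition _ (T : finType) := [Finite of sgraph T by <:].

(* Taking u = v in the condition excludes loops. *)
Definition asym (V : finType) (A : {set V * V}) : bool :=
  [forall u, forall v, ((u, v) \in A) ==> ((v, u) \notin A)].

Record ograph (V : finType) := OGraph {
  arcs : {set V * V};
  arcs_asym : asym arcs }.

HB.instance Definition _ (V : finType) := [isSub for @arcs V].
HB.instance Definition _ (V : finType) := [Finite of ograph V by <:].

Definition orientation_of (T : finType) (G : sgraph T) (O : ograph T) : bool :=
  [forall u, forall v,
    ([set u; v] \in edges G) == (((u, v) \in arcs O) || ((v, u) \in arcs O))].

(* A copy is a subgraph isomorphic to H, not necessarily induced. *)
Definition has_copy (V T : finType) (H : ograph V) (O : ograph T) : bool :=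
  [exists f : {ffun V -> T}, injectiveb f &&
    [forall u, forall v, ((u, v) \in arcs H) ==> ((f u, f v) \in arcs O)]].

Definition D (V T : finType) (G : sgraph T) (H : ograph V) : nat :=
  #|[set O : ograph T | orientation_of G O && ~~ has_copy H O]|.

Definition C3_arcs : {set 'I_3 * 'I_3} := [set (i, ordS i) | i : 'I_3].

Lemma C3_asym : asym C3_arcs.
Proof.
apply/'forall_forallP => u v; apply/implyP => /imsetP[i _ [-> ->]].
apply/imsetP => -[j _ [/(congr1 val) /= e1 /(congr1 val) /= e2]].
by case: i j e1 e2 => [[|[|[|]]] //= ?] [[|[|[|]]] //= ?].
Qed.

Definition C3 : ograph 'I_3 := OGraph C3_asym.

Local Open Scope ring_scope.

(* The law of G(n,p): each pair of vertices is an edge with probability p,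
   independently of the other pairs. *)
Definition gnp_mass (R : realFieldType) (n : nat) (p : R)
    (G : sgraph 'I_n) : R :=
  \prod_(e in pairs 'I_n) (if e \in edges G then p else 1 - p).

Definition gnp_prob (R : realFieldType) (n : nat) (p : R)
    (A : pred (sgraph 'I_n)) : R :=
  \sum_(G | A G) gnp_mass p G.

(* Main.v *)
(* Let i(G) be the number of independent sets of G, and let O be an orientation
   of G without directed triangles. For a vertex v, let N be the set of
   neighbours of v preceding it in the vertex order. The out-neighbours of v in
   N are closed under the arcs of O inside N (otherwise v -> x -> y -> v), and
   a minimal set generating them under reachability inside N is independent.
   Given O on the vertices before v, this independent set determines O on the
   edges from v to N; hence D(G, C3) <= i(G)^n.
   With L = log n, E i(G(n,p)) = \sum_S (1-p)^'C(|S|, 2)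
   <= e * exp((L + p/2)^2 / (2p)), so by Markov's inequality i(G) exceeds
   exp(6 L^2 / p) with probability at most 1/n. *)
Require Import Defs.
From mathcomp Require Import all_boot all_order all_algebra.
From mathcomp Require Import all_classical all_reals all_analysis.
From mathcomp Require Import ring lra.
Import Order.TTheory GRing.Theory Num.Theory.
Import numFieldNormedType.Exports.
Local Open Scope classical_set_scope.
Local Open Scope ring_scope.

Set Implicit Arguments.
Unset Strict Implicit.
Unset Printing Implicit Defensive.

(** * Independent sets and generation under reachability *)

Definition independent {T : finType} (G : sgraph T) (S : {set T}) : bool :=
  [forall e, (e \in edges G) ==> ~~ (e \subset S)].

Definition num_independent {T : finType} (G : sgraph T) : nat :=
  #|[set S | independent G S]%SET|.

Definition reach {T : finType} (r : rel T) (Q : {set T}) : {set T} :=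
  [set y | [exists x in Q, connect r x y]].

Lemma edge_neq {T : finType} (G : sgraph T) (u v : T) :
  [set u; v]%SET \in edges G -> u != v.
Proof.
move=> /(fintype.subsetP (edges_pairs G)); rewrite inE cards2.
by case: (u != v).
Qed.

(** An inclusion-minimal generating set works: if it contains distinct [x], [y] with [r x y],
    everything reached from [y] is also reached from [x], so [y] could be dropped. Closure makes [A]
    generate itself, so a minimal set exists. *)
Lemma exists_sparse_generators {T : finType} (r : rel T) (A : {set T}) :
    (forall x y, x \in A -> r x y -> y \in A) ->
  exists2 Q : {set T}, reach r Q = A &
    forall x y, x \in Q -> y \in Q -> x != y -> ~~ r x y.
Proof.
move=> clA.
have reachA : reach r A == A.
  apply/eqP/setP => y; rewrite inE; apply/existsP/idP => [[x /andP[xA]]|yA].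
    move=> /connectP[s rs ->]; elim: s x xA rs => //= z s IH x xA /andP[rxz].
    exact/IH/(clA x).
  by exists y; rewrite yA connect0.
have [Q /minsetP[/eqP rQ minQ] _] := minset_exists (P := fun Q => reach r Q == A) reachA.
exists Q => // x y xQ yQ xy; apply/negP => rxy.
have /setP/(_ y) : (Q :\ y = Q)%SET.
  apply: minQ; last exact: subD1set.
  rewrite -rQ; apply/eqP/setP => z; rewrite !inE.
  apply/existsP/existsP => [[w /andP[]]|[w /andP[wQ wz]]].
    by rewrite !inE => /andP[_ wQ] wz; exists w; rewrite wQ.
  have [wy|wy] := eqVneq w y; last by exists w; rewrite !inE wy wQ.
  exists x; rewrite !inE xy xQ /=; apply: connect_trans wz.
  by rewrite wy connect1.
by rewrite !inE eqxx yQ.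
Qed.

(** * Encoding triangle-free orientations by independent sets *)

Section Encoding.
Context {n : nat} (G : sgraph 'I_n).
Implicit Types (O : ograph 'I_n) (u v w : 'I_n).

Definition back_nbr v u : bool := (u < v)%N && ([set v; u]%SET \in edges G).

Definition back_out O v : {set 'I_n} :=
  [set u | back_nbr v u && ((v, u) \in arcs O)].

Definition back_rel O v : rel 'I_n :=
  fun u w => [&& back_nbr v u, back_nbr v w & (u, w) \in arcs O].

Definition encodes O v (Q : {set 'I_n}) : bool :=
  independent G Q && (reach (back_rel O v) Q == back_out O v).

(** For orientations without a directed triangle the default value is never reached, by [codeP].
    Which [Q] is picked is irrelevant: decoding only uses that it generates [back_out O v]. *)
Definition code O v : {set 'I_n} := odflt finset.set0 [pick Q | encodes O v Q].

Lemma oriented_edge O u v : orientation_of G O ->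
  ([set u; v]%SET \in edges G) = ((u, v) \in arcs O) || ((v, u) \in arcs O).
Proof. by move=> /forallP/(_ u)/forallP/(_ v)/eqP. Qed.

Lemma arc_asym O u v : (u, v) \in arcs O -> (v, u) \notin arcs O.
Proof. by have /forallP/(_ u)/forallP/(_ v)/implyP := arcs_asym O. Qed.

Lemma has_C3 O u v w : (u, v) \in arcs O -> (v, w) \in arcs O ->
  (w, u) \in arcs O -> has_copy C3 O.
Proof.
move=> uv vw wu.
have loop x : (x, x) \notin arcs O.
  by apply/negP => xx; have := arc_asym xx; rewrite xx.
pose f := [ffun i : 'I_3 => nth u [:: u; v; w] i].
apply/existsP; exists f; apply/andP; split; last first.
  apply/'forall_forallP => x y; apply/implyP => /imsetP[i _ [-> ->]].
  by rewrite !ffunE; case: i => [[|[|[|]]]].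
have uniq_uvw : uniq [:: u; v; w].
  rewrite /= !inE negb_or -!andbA; apply/and4P; split => //.
  - by apply: contraTneq uv => ->.
  - by apply: contraTneq wu => ->.
  - by apply: contraTneq vw => ->.
apply/injectiveP => i j; rewrite !ffunE => /eqP.
by rewrite nth_uniq // => /eqP/val_inj.
Qed.

Lemma codeP O v : orientation_of G O -> ~~ has_copy C3 O ->
  encodes O v (code O v).
Proof.
move=> orO C3O; rewrite /code; case: pickP => //= noQ.
have [|Q rQ indQ] := @exists_sparse_generators _ (back_rel O v) (back_out O v).
  (* Given [v -> x -> y], the edge between [v] and [y] must be [v -> y], since [y -> v] closes a
     triangle. *)
  move=> x y; rewrite !inE => /andP[_ vx] /and3P[_ yv xy]; rewrite yv /=.
  have [_] := andP yv; rewrite (oriented_edge _ _ orO) => /orP[//|yv'].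
  by case/negP: C3O; exact: has_C3 vx xy yv'.
have Qv x : x \in Q -> back_nbr v x.
  move=> xQ; have : x \in back_out O v.
    by rewrite -rQ inE; apply/existsP; exists x; rewrite xQ connect0.
  by rewrite inE => /andP[].
have := noQ Q; rewrite /encodes rQ eqxx andbT => /negP[].
(* All of [Q] lies among the earlier neighbours of [v], so an edge inside [Q] would be a [back_rel]
   arc in one of its two directions. *)
apply/forallP => e; apply/implyP => eG; apply/negP => eQ.
have := fintype.subsetP (edges_pairs G) e eG.
rewrite inE => /cards2P[x [y [xy eE]]].
have xQ : x \in Q by apply: (fintype.subsetP eQ); rewrite eE !inE eqxx.
have yQ : y \in Q by apply: (fintype.subsetP eQ); rewrite eE !inE eqxx orbT.
have := indQ _ _ xQ yQ xy; rewrite eq_sym in xy.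
have := indQ _ _ yQ xQ xy; rewrite /back_rel !Qv //=.
move: eG; rewrite eE (oriented_edge _ _ orO) => /orP[->|->] //.
Qed.

(** Decoding goes through the vertices in order: agreement before [v] makes the two relations
    [back_rel] at [v] equal, and the common code then generates the same out-neighbours. *)
Lemma code_inj O1 O2 :
    orientation_of G O1 -> ~~ has_copy C3 O1 ->
    orientation_of G O2 -> ~~ has_copy C3 O2 ->
  (forall v, code O1 v = code O2 v) -> O1 = O2.
Proof.
move=> or1 C1 or2 C2 eqc.
(* The bound [m] turns induction on ordinals into strong induction on naturals. *)
have outE m v : (v <= m)%N -> back_out O1 v = back_out O2 v.
  elim/ltn_ind: m v => m IH v vm.
  (* The arc [u -> w] is read off at the later endpoint [u]; on an edge, the reverse arc is its
     negation. *)
  have lowE u w : (u < v)%N -> (w < u)%N ->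
      [set u; w]%SET \in edges G ->
      (((u, w) \in arcs O1) = ((u, w) \in arcs O2)) /\
      (((w, u) \in arcs O1) = ((w, u) \in arcs O2)).
    move=> uv wu uw; have /setP/(_ w) := IH u (leq_trans uv vm) u (leqnn _).
    rewrite !inE /back_nbr wu uw /= => E; split => //.
    have dir O : orientation_of G O ->
        ((w, u) \in arcs O) = ~~ ((u, w) \in arcs O).
      move=> orO; move: uw; rewrite (oriented_edge _ _ orO).
      by have [/arc_asym/negbTE ->|_ /= ->] := boolP ((u, w) \in arcs O).
    by rewrite !dir // E.
  have relE : back_rel O1 v =2 back_rel O2 v.
    move=> u w; rewrite /back_rel; case: (boolP (back_nbr v u)) => //= /andP[uv _].
    case: (boolP (back_nbr v w)) => //= /andP[wv _].
    have [uw|uw] := boolP ([set u; w]%SET \in edges G); last first.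
      move: (uw); rewrite (oriented_edge _ _ or1) negb_or => /andP[/negbTE -> _].
      by move: uw; rewrite (oriented_edge _ _ or2) negb_or => /andP[/negbTE -> _].
    have := edge_neq uw; case: (ltngtP u w) => [uw'|wu'|/val_inj ->] _.
    - by rewrite finset.setUC in uw; have [] := lowE w u wv uw' uw.
    - by have [] := lowE u w uv wu' uw.
    - apply/idP/idP => xx; have := arc_asym xx; by rewrite xx.
  have /andP[_ /eqP <-] := codeP v or1 C1.
  have /andP[_ /eqP <-] := codeP v or2 C2.
  apply/setP => y; rewrite !inE eqc.
  by apply: eq_existsb => x; rewrite (eq_connect relE).
(* Every edge is seen from its later endpoint, so the sets [back_out] determine all arcs. *)
have sub O O' : orientation_of G O -> orientation_of G O' ->
    (forall v, back_out O v = back_out O' v) -> arcs O \subset arcs O'.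
  move=> orO orO' E; apply/fintype.subsetP => -[u w] uw.
  have euw : [set u; w]%SET \in edges G by rewrite (oriented_edge _ _ orO) uw.
  have := edge_neq euw; case: (ltngtP u w) => [uw'|wu'|/val_inj ->].
  - have /setP/(_ u) := E w; rewrite !inE /back_nbr uw' finset.setUC euw /=.
    rewrite (negbTE (arc_asym uw)); move: euw.
    by rewrite (oriented_edge _ _ orO') => /orP[//|->].
  - by have /setP/(_ w) := E u; rewrite !inE /back_nbr wu' euw uw /= => <-.
  - by rewrite eqxx.
apply/val_inj/eqP; rewrite finset.eqEsubset /=.
by apply/andP; split; apply: sub => // v; rewrite (outE v).
Qed.

Lemma D_C3_le : (D G C3 <= num_independent G ^ n)%N.
Proof.
pose F O := [ffun v => code O v].
rewrite /D -(card_in_imset (f := F)); last first.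
  move=> O1 O2; rewrite !inE => /andP[or1 C1] /andP[or2 C2] /ffunP E.
  by apply: code_inj => // v; have := E v; rewrite !ffunE.
rewrite -[X in (_ ^ X)%N](card_ord n) -card_ffun_on.
apply/subset_leq_card/fintype.subsetP => _ /imsetP[x + ->].
rewrite inE => /andP[orx Cx]; apply/ffun_onP => v.
by rewrite ffunE inE; have /andP[] := codeP v orx Cx.
Qed.

End Encoding.

(** * Independent sets in the random graph *)

Section RandomGraph.
Context {R : realType} (n : nat) (p : R).
Hypotheses (p_gt0 : 0 < p) (p_le1 : p <= 1).

Lemma gnp_mass_ge0 (G : sgraph 'I_n) : 0 <= gnp_mass p G.
Proof. by apply: prodr_ge0 => e _; case: ifP => _; rewrite ?subr_ge0 // ltW. Qed.

(** Expand the product of [F e + H e]: the term of a family [J] is the mass of the graph with edge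
    set [J], or 0 if [J] contains a non-pair or a pair inside [S]. Pairs inside [S] give the factor
    [1 - p], all other sets the factor 1. *)
Lemma gnp_prob_independent (S : {set 'I_n}) :
  gnp_prob p (fun G => independent G S) = (1 - p) ^+ 'C(#|S|, 2).
Proof.
pose F (e : {set 'I_n}) := if (e \in pairs 'I_n) && ~~ (e \subset S) then p else 0.
pose H (e : {set 'I_n}) := if e \in pairs 'I_n then 1 - p else 1.
have <- : \prod_e (F e + H e) = (1 - p) ^+ 'C(#|S|, 2).
  rewrite -cards_draws -prodr_const [RHS]big_mkcond; apply: eq_bigr => e _.
  rewrite /F /H !inE [in RHS]andbC; case: (#|e| == 2) => /=; last by rewrite add0r.
  case: (e \subset S) => /=; first by rewrite add0r.
  by rewrite subrKC.
rewrite bigA_distr /gnp_prob.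
rewrite [RHS](bigID (fun J : {set {set 'I_n}} =>
  (J \subset pairs 'I_n) && [forall e, (e \in J) ==> ~~ (e \subset S)])) /=.
rewrite [X in _ = _ + X]big1 ?addr0; last first.
  move=> J; rewrite negb_and => bad.
  have [e eJ Fe] : exists2 e, e \in J & F e = 0.
    case/orP: bad => [/fintype.subsetPn[e eJ eN]|].
      by exists e => //; rewrite /F (negbTE eN).
    by case/forallPn => e; rewrite negb_imply negbK => /andP[eJ eS];
      exists e => //; rewrite /F eS andbF.
  by rewrite (bigD1 e) //= eJ Fe mul0r.
rewrite (reindex_omap (@edges 'I_n) (insub : _ -> option (sgraph 'I_n))) /=; last first.
  by move=> J /andP[sJ _]; rewrite insubT.
apply: eq_big => [G|G indG].
  by rewrite edges_pairs /= (valK G) eqxx andbT.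
rewrite /gnp_mass big_mkcond; apply: eq_bigr => e _.
rewrite /F /H; have [eG|eG] := boolP (e \in edges G).
  rewrite (fintype.subsetP (edges_pairs G) _ eG) /=.
  by move/forallP: indG => /(_ e); rewrite eG /= => ->.
by case: ifP.
Qed.

Lemma gnp_mass_total : \sum_(G : sgraph 'I_n) gnp_mass p G = 1.
Proof.
(* The empty set is independent in every graph. *)
have := gnp_prob_independent finset.set0; rewrite cards0 expr0 => <-.
apply: eq_bigl => G; apply/esym/forallP => e; apply/implyP => eG.
have := fintype.subsetP (edges_pairs G) _ eG; rewrite inE => /eqP e2.
by rewrite finset.subset0 -cards_eq0 e2.
Qed.

Lemma expected_num_independent :
  \sum_(G : sgraph 'I_n) gnp_mass p G * (num_independent G)%:R =
  \sum_(S : {set 'I_n}) (1 - p) ^+ 'C(#|S|, 2).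
Proof.
under [RHS]eq_bigr => S _ do rewrite -gnp_prob_independent /gnp_prob big_mkcond.
rewrite exchange_big; apply: eq_bigr => G _ /=.
rewrite -big_mkcond sumr_const /num_independent mulr_natr.
by congr (_ *+ _); exact: cardsE.
Qed.

Lemma sum_expr_card (x : R) :
  \sum_(S : {set 'I_n}) x ^+ #|S| = (x + 1) ^+ n.
Proof.
rewrite -[n in RHS]card_ord -prodr_const bigA_distr; apply: eq_bigr => S _.
by rewrite -big_mkcond /= prodr_const.
Qed.

(* The exponent [- p * j * (j - 1) / 2] is bounded by its tangent line of slope [- a]. *)
Lemma expr_bin2_le (j : nat) (a : R) :
  (1 - p) ^+ 'C(j, 2) <= expR ((a + p / 2) ^+ 2 / (2 * p)) * expR (- a) ^+ j.
Proof.
have := expR_ge1Dx (- p); set q := 1 - p => qe.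
have q0 : 0 <= q by rewrite subr_ge0.
apply: le_trans (lerXn2r _ _ _ qe) _; rewrite ?nnegrE ?expR_ge0 //.
rewrite -!expRM_natl -expRD ler_expR.
have -> : ('C(j, 2))%:R = j%:R * (j%:R - 1) / 2 :> R.
  have : ('C(j, 2))%:R * 2 = j%:R * (j%:R - 1) :> R.
    case: j => [|j]; first by rewrite mul0r mul0r.
    rewrite -natrM -[X in _ = _ * X]/(_ - 1%:R) -natrB // subn1 -natrM.
    by rewrite mulnC -mul_bin_diag bin1.
  by move=> <-; rewrite mulfK.
rewrite -subr_ge0.
have -> : (a + p / 2) ^+ 2 / (2 * p) + j%:R * - a - j%:R * (j%:R - 1) / 2 * - p =
  (p * j%:R - (a + p / 2)) ^+ 2 / (2 * p) by field; rewrite gt_eqF.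
by rewrite divr_ge0 ?sqr_ge0 // mulr_ge0 // ltW.
Qed.

Lemma expected_num_independent_le : (0 < n)%N ->
  \sum_(G : sgraph 'I_n) gnp_mass p G * (num_independent G)%:R <=
  expR ((ln (n%:R : R) + p / 2) ^+ 2 / (2 * p) + 1).
Proof.
move=> n0; have n0R : 0 < n%:R :> R by rewrite ltr0n.
rewrite expected_num_independent.
(* Slope [a = ln n] makes the sum over [S] equal to [(1 + 1/n)^n], which is at most [e]. *)
apply: (@le_trans _ _
  (\sum_(S : {set 'I_n}) expR ((ln n%:R + p / 2) ^+ 2 / (2 * p)) * expR (- ln n%:R) ^+ #|S|)).
  by apply: ler_sum => S _; exact: expr_bin2_le.
rewrite -mulr_sumr sum_expr_card expRD ler_wpM2l ?expR_ge0 //.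
rewrite expRN lnK ?posrE // addrC.
have -> : expR 1 = expR (n%:R^-1 : R) ^+ n.
  by rewrite -expRM_natl mulfV ?gt_eqF.
by rewrite lerXn2r ?nnegrE ?expR_ge0 ?expR_ge1Dx // addr_ge0 // invr_ge0 ltW.
Qed.

(** Markov's inequality, passed to the complementary event. *)
Lemma num_independent_tail (M : R) : 0 < M ->
  1 - (\sum_(G : sgraph 'I_n) gnp_mass p G * (num_independent G)%:R) / M <=
  gnp_prob p (fun G : sgraph 'I_n => (num_independent G)%:R <= M).
Proof.
move=> M0; rewrite lerBlDr -[leLHS]gnp_mass_total.
rewrite (bigID (fun G : sgraph 'I_n => (num_independent G)%:R <= M)) /= /gnp_prob lerD2l.
rewrite mulr_suml big_mkcond ler_sum // => G _.
have m0 := gnp_mass_ge0 G; case: ifPn => [|_]; last first.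
  by rewrite !mulr_ge0 // invr_ge0 ltW.
rewrite -ltNge => MG; rewrite -mulrA ler_peMr // ler_pdivlMr // mul1r.
exact: ltW.
Qed.

Lemma gnp_prob_le (A B : pred (sgraph 'I_n)) :
  (forall G, A G -> B G) -> gnp_prob p A <= gnp_prob p B.
Proof.
move=> AB; rewrite /gnp_prob big_mkcond [leRHS]big_mkcond ler_sum // => G _.
have := gnp_mass_ge0 G.
by have [/AB ->|] := boolP (A G); case: (B G).
Qed.

Lemma gnp_prob_le1 (A : pred (sgraph 'I_n)) : gnp_prob p A <= 1.
Proof. by rewrite -gnp_mass_total; exact: gnp_prob_le. Qed.

Lemma gnp_prob_num_independent_ge : 1 <= ln (n%:R : R) ->
  1 - n%:R^-1 <= gnp_prob p (fun G : sgraph 'I_n =>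
    (num_independent G)%:R <= expR (6 * ln (n%:R : R) ^+ 2 / p)).
Proof.
set L := ln _ => L1.
have n0 : (0 < n)%N.
  (* Since [ln 0 = 0] by convention, [1 <= L] excludes [n = 0]. *)
  by rewrite lt0n; apply/eqP => n0; move: L1; rewrite /L n0 ln0 // ler10.
apply: le_trans (num_independent_tail (expR_gt0 _)).
rewrite lerB // ler_pdivrMr ?expR_gt0 //.
apply: le_trans (expected_num_independent_le n0) _.
rewrite -[n%:R^-1]lnK ?posrE ?invr_gt0 ?ltr0n // lnV ?posrE ?ltr0n // -/L.
rewrite -expRD ler_expR -subr_ge0.
have -> : - L + 6 * L ^+ 2 / p - ((L + p / 2) ^+ 2 / (2 * p) + 1) =
  (44 * L ^+ 2 - 12 * L * p - p ^+ 2 - 8 * p) / (8 * p).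
  by field; rewrite gt_eqF.
(* With [p <= 1 <= L], these bounds make the numerator at least [32 * L ^+ 2 - 9], hence
   positive. *)
have LL : L <= L ^+ 2 by rewrite expr2 ler_peMr //; lra.
have Lp : L * p <= L by rewrite ler_piMr //; lra.
have pp : p ^+ 2 <= p by rewrite expr2 ler_piMr // ltW.
by rewrite divr_ge0 //; move: (p_gt0) (p_le1) => p0 p1; lra.
Qed.

End RandomGraph.

(** * Passage to the limit *)

Theorem theorem3p1 (R : realType) (p : nat -> R)
    (hp : forall n : nat, 0 < p n /\ p n <= 1) :
  gnp_prob (p n) (fun G : sgraph 'I_n =>
    (D G C3)%:R <= expR (6 * n%:R * ln (n%:R : R) ^+ 2 / p n))
  @[n --> \oo] --> (1 : R).
Proof.
have inv_cvg0 : (n%:R^-1 : R) @[n --> \oo] --> (0 : R).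
  by rewrite -cvg_shiftS; exact: cvg_harmonic.
apply: (@squeeze_cvgr _ _ _ _ (fun n => 1 - n%:R^-1) (fun=> 1)).
- near=> n.
  have [p0 p1] := hp n; apply/andP; split; last exact: gnp_prob_le1.
  (* Eventually [n >= e], which gives the required [ln n >= 1]. *)
  have en : expR 1 <= n%:R :> R by near: n; exact: nbhs_infty_ger.
  have n0 : 0 < n%:R :> R by apply: lt_le_trans en; exact: expR_gt0.
  have L1 : 1 <= ln (n%:R : R) by rewrite -[leLHS]expRK ler_ln ?posrE ?expR_gt0.
  apply: le_trans (gnp_prob_num_independent_ge p0 p1 L1) _.
  apply: gnp_prob_le => // G iG.
  (* Raising the bound on the number of independent sets to the power [n] multiplies its exponent by
     [n]. *)
  apply: le_trans (_ : (num_independent G ^ n)%:R <= _).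
    by rewrite ler_nat D_C3_le.
  have -> : 6 * n%:R * ln (n%:R : R) ^+ 2 / p n =
    n%:R * (6 * ln (n%:R : R) ^+ 2 / p n) by ring.
  by rewrite natrX expRM_natl lerXn2r ?nnegrE ?expR_ge0.
- by rewrite -[X in _ --> X]subr0; apply: cvgB => //; exact: cvg_cst.
- exact: cvg_cst.
Unshelve. all: by end_near.
Qed.
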